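(* Let $p\ge 2$ and $1<\alpha<\min\{n,p\}$, and let $p^*=\frac{np}{n-\alpha}$. There exists a constant $c_{n,p,\alpha}>0$, depending only on $n,p,\alpha$, such that for every convex domain $\Omega\subseteq\mathbb{R}^n$ with nonempty boundary and every $f\in C_c^\infty(\Omega)$, $$\int_{\Omega\times\Omega}\frac{|f(x)-f(y)|^p}{|x-y|^{n+\alpha}}\,dx\,dy \;\ge\; c_{n,p,\alpha}\left(\int_{\Omega}|f(x)|^{p^*}\,dx\right)^{p/p^*}.$$
   Context: $n$ is a positive integer (the hypothesis $1<\alpha<n$ forces $n\ge2$). A domain is an open connected subset of $\mathbb{R}^n$. *)

(* Defs.v *)
From HB Require Import structures.
From mathcomp Require Import all_boot all_order all_algebra.
From mathcomp Require Import all_classical all_reals all_analysis.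

Set Implicit Arguments.
Unset Strict Implicit.
Unset Printing Implicit Defensive.

Import Order.TTheory GRing.Theory Num.Theory.
Import numFieldNormedType.Exports.

Local Open Scope classical_set_scope.
Local Open Scope ring_scope.

(* The vectors of R^n are the row vectors 'rV[R]_n.  Their library topology is
   that of the sup norm, i.e. the usual one. *)

HB.instance Definition _ (T : pointedType) (m n : nat) :=
  isPointed.Build 'M[T]_(m, n) (const_mx point).

Section measurable_rV.
Context {d : measure_display} {T : sigmaRingType d}.
Variable n : nat.

Let coord : 'I_n -> 'rV[T]_n -> T := fun i v => v ord0 i.

Let rV_set0 : g_sigma_preimage coord set0.
Proof. exact: sigma_algebra0. Qed.

Let rV_setC A : g_sigma_preimage coord A -> g_sigma_preimage coord (~` A).
Proof. exact: sigma_algebraC. Qed.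

Let rV_bigcup (F : (set 'rV[T]_n)^nat) :
  (forall i, g_sigma_preimage coord (F i)) ->
  g_sigma_preimage coord (\bigcup_i (F i)).
Proof. exact: sigma_algebra_bigcup. Qed.

(* Product sigma-algebra, generated by the coordinates as for n.-tuple T; for
   T = R it is the Borel sigma-algebra of R^n. *)
HB.instance Definition _ := @isMeasurable.Build (measure_tuple_display d)
  'rV[T]_n (g_sigma_preimage coord) rV_set0 rV_setC rV_bigcup.

End measurable_rV.


Lemma measurable_coord d (T : sigmaRingType d) n (i : 'I_n) :
  measurable_fun [set: 'rV[T]_n] (fun v => v ord0 i).
Proof.
move=> _ Y mY; rewrite setTI; apply: sub_sigma_algebra => /=.
rewrite -bigcup_seq/=; exists i => /=; first by rewrite mem_index_enum.
by exists Y => //; rewrite setTI.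
Qed.

Lemma measurable_fun_coordP d1 d2 (T1 : measurableType d1)
    (T2 : measurableType d2) n (f : T1 -> 'rV[T2]_n) :
  measurable_fun [set: T1] f <->
  forall i, measurable_fun [set: T1] (fun x => f x ord0 i).
Proof.
split=> [mf i|mf].
  exact: (measurableT_comp (@measurable_coord _ T2 n i) mf).
apply: (@measurability _ _ _ _ _ f
  (\big[setU/set0]_(i < n) preimage_set_system setT
     ((fun i v => v ord0 i) i : 'rV[T2]_n -> T2) measurable)) => //.
move=> _ [B + <-]; rewrite -bigcup_seq => -[i _ [A mA <-]].
by rewrite !setTI -comp_preimage -[X in measurable X]setTI; exact: mf.
Qed.

Section lebesgue_rV.
Context {R : realType}.
Local Open Scope ereal_scope.

Definition cons_rV n (z : measurableTypeR R * 'rV[R]_n) : 'rV[R]_n.+1 :=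
  \row_i oapp (z.2 ord0) z.1 (unlift ord0 i).

Definition uncons_rV n (v : 'rV[R]_n.+1) : measurableTypeR R * 'rV[R]_n :=
  (v ord0 ord0, \row_i v ord0 (lift ord0 i)).

Lemma cons_rVK n : cancel (@cons_rV n) (@uncons_rV n).
Proof.
case=> x v; rewrite /uncons_rV /cons_rV !mxE unlift_none/=; congr pair.
by apply/rowP => i; rewrite !mxE liftK.
Qed.

Lemma measurable_cons_rV n : measurable_fun [set: _] (@cons_rV n).
Proof.
apply/measurable_fun_coordP => i.
case: (unliftP ord0 i) => [j|] ->.
  under eq_fun do rewrite mxE liftK/=.
  exact: (measurableT_comp (@measurable_coord _ R n j) measurable_snd).
under eq_fun do rewrite mxE unlift_none/=.
exact: measurable_fst.
Qed.

Lemma measurable_uncons_rV n : measurable_fun [set: _] (@uncons_rV n).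
Proof.
apply: measurable_fun_pair; first exact: (@measurable_coord _ R n.+1 ord0).
apply/measurable_fun_coordP => i /=.
under eq_fun do rewrite mxE.
exact: (@measurable_coord _ R n.+1 (lift ord0 i)).
Qed.

Section step.
Variables (n : nat) (mu : {sigma_finite_measure set 'rV[R]_n -> \bar R}).

Let step : set 'rV[R]_n.+1 -> \bar R :=
  pushforward (@lebesgue_measure R \x mu) (@cons_rV n).

Let step0 : step set0 = 0.
Proof. by rewrite /step /pushforward preimage_set0 measure0. Qed.

Let step_ge0 A : 0 <= step A.
Proof. by rewrite /step /pushforward measure_ge0. Qed.

Let step_sigma_additive : semi_sigma_additive step.
Proof.
apply: measure_semi_sigma_additive; exact: measurable_cons_rV.
Qed.

HB.instance Definition _ := isMeasure.Build _ _ _ step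
  step0 step_ge0 step_sigma_additive.

Let step_sigma_finite : sigma_finite [set: 'rV[R]_n.+1] step.
Proof.
have /sigma_finiteP[F [FT ndF Foo]] := sigma_finiteT (@lebesgue_measure R).
have /sigma_finiteP[G [GT ndG Goo]] := sigma_finiteT mu.
exists (fun k => @uncons_rV n @^-1` (F k `*` G k)).
  rewrite -preimage_bigcup (_ : \bigcup_i _ = setT) ?preimage_setT//.
  rewrite -subTset => -[x v] _.
  have [i _ Fx] : (\bigcup_i F i) x by rewrite -FT.
  have [j _ Gv] : (\bigcup_i G i) v by rewrite -GT.
  exists (maxn i j) => //; split => /=.
    by move: x Fx; exact/subsetPset/ndF/leq_maxl.
  by move: v Gv; exact/subsetPset/ndG/leq_maxr.
move=> k; have [mF Fk] := Foo k; have [mG Gk] := Goo k; split.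
  rewrite -[X in measurable X]setTI; apply: measurable_uncons_rV => //.
  exact: measurableX.
rewrite /step /pushforward -comp_preimage (_ : _ \o _ = id).
  by rewrite preimage_id product_measure1E// lte_mul_pinfty// ge0_fin_numE.
by apply/funext => z; exact: cons_rVK.
Qed.

HB.instance Definition _ := @Measure_isSigmaFinite.Build _ _ _ step
  step_sigma_finite.

Definition lebesgue_rV_step :
  {sigma_finite_measure set 'rV[R]_n.+1 -> \bar R} := step.

End step.

Fixpoint lebesgue_rV n : {sigma_finite_measure set 'rV[R]_n -> \bar R} :=
  if n is m.+1 then lebesgue_rV_step (lebesgue_rV m)
  else \d_(0%R : 'rV[R]_0).

Lemma lebesgue_rV_box n (A : 'I_n -> set (measurableTypeR R)) :
  (forall i, measurable (A i)) ->
  lebesgue_rV n [set v | forall i, A i (v ord0 i)] =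
  \prod_(i < n) lebesgue_measure (A i).
Proof.
elim: n A => [|n IH] A mA.
  rewrite big_ord0 /= diracE mem_set// => -[]//.
rewrite big_ord_recl -IH// -product_measure1E//=; last first.
  rewrite [X in measurable X](_ : _ =
      \bigcap_(i in [set: 'I_n]) ((fun v : 'rV[R]_n => v ord0 i) @^-1` A (lift ord0 i))).
    apply: fin_bigcap_measurable => // i _; rewrite -[X in measurable X]setTI.
    exact: (@measurable_coord _ R n i measurableT _ (mA (lift ord0 i))).
  by apply/seteqP; split => v /= Av i; [move=> _|]; exact: Av.
rewrite /pushforward; congr (_ _); apply/seteqP; split => -[x v] /=.
  move=> Av; split => [|i].
    by have := Av ord0; rewrite mxE unlift_none.
  by have := Av (lift ord0 i); rewrite mxE liftK.
by move=> [Ax Av] i; rewrite mxE; case: (unliftP ord0 i) => [j|] ->.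
Qed.
End lebesgue_rV.

Section domains.
Context {R : realType} {n : nat}.
Implicit Types (Omega : set 'rV[R]_n) (f : 'rV[R]_n -> R).

(* The library norm `|v| on 'rV[R]_n is the sup norm. *)
Definition enorm (v : 'rV[R]_n) : R := Num.sqrt (\sum_(i < n) v ord0 i ^+ 2).

Definition domain Omega := open Omega /\ connected Omega.

Definition boundary Omega := closure Omega `\` Omega°.

Definition partial (i : 'I_n) f : 'rV[R]_n -> R := 'D_(delta_mx ord0 i) f.

Definition iter_partial (s : seq 'I_n) f := foldr partial f s.

Definition smooth f := forall s : seq 'I_n,
  continuous (iter_partial s f) /\
  forall i x, derivable (iter_partial s f) x (delta_mx ord0 i).

Definition supp f := closure [set x | f x != 0].

(* C_c^oo(Omega), each element being identified with its extension by zero to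
   R^n. *)
Definition test_function Omega f :=
  [/\ smooth f, compact (supp f) & supp f `<=` Omega].

End domains.

(* Main.v *)
Require Import Defs.
From HB Require Import structures.
From mathcomp Require Import all_boot all_order all_algebra.
From mathcomp Require Import all_classical all_reals all_analysis.
From mathcomp Require Import measurable_realfun ring lra.

(* Write s = n + alpha, k(h) = |h|^-s (sup norm) and q = pstar; f vanishes
   outside Omega.  Two estimates are combined.

   Hardy.  Let x + h be outside Omega and y = x + h/2.  Either y is outside
   Omega as well, or |f x|^p <= (1 + d)^p |f y|^p + (1 + 1/d)^p |f x - f y|^p,
   where y + h/2 is outside Omega.  Let I be the integral of
   k(h) |f x|^p over the pairs with x + h outside Omega, and J the integral of
   k(h) |f x - f (x + h)|^p over the pairs inside Omega.  Translating by h/2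
   and scaling h by 2 gives
     I <= 2^-alpha ((1 + (1 + d)^p) I + (1 + 1/d)^p J),
   and (1 + d)^p = 2^(alpha - 1) makes the coefficient of I equal to
   2^-alpha + 1/2 < 1; this is where alpha > 1 is used.  Cutting k off at
   |h| <= M makes I finite, so that it can be absorbed.

   Sobolev.  Let S be the integral of |f|^q and t = |f x| > 0.  By Markov's
   inequality |f| > t/2 holds on a set of measure at most m = 2^q S / t^q, so
   |f x - f (x + h)| >= t/2 on at least half of the cube of measure 2m centred
   at h = 0.  Hence the integral of k(h) |f x - f (x + h)|^p in h is
   at least a constant times S^(-alpha/n) |f x|^q, and integrating in x gives
   S^(1 - alpha/n) <= C (I + J), where 1 - alpha/n = p/q. *)

Import Order.TTheory GRing.Theory Num.Theory.
Import numFieldNormedType.Exports.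

Local Open Scope classical_set_scope.
Local Open Scope ring_scope.

(** * Lebesgue measure on row vectors *)

Section lebesgue_line.
Context {R : realType}.
Local Open Scope ereal_scope.
Local Notation mu := (@lebesgue_measure R).

Lemma measurable_affine (a b : R) :
  measurable_fun setT (fun x : measurableTypeR R => (a * x + b)%R : measurableTypeR R).
Proof. by apply: measurable_funD => //; exact: measurable_funM. Qed.

(** By uniqueness of Lebesgue measure: [a] times the pushforward gives every half-open interval its
    length. *)
Lemma lebesgue_measure_affine (a b : R) (A : set (measurableTypeR R)) :
  (0 < a)%R -> measurable A ->
  pushforward mu (fun x : measurableTypeR R => (a * x + b)%R : measurableTypeR R) A
  = (a^-1)%:E * mu A.
Proof.
move=> a0 mA.
have an0 : (0 <= a)%R := ltW a0.
pose phi (x : measurableTypeR R) : measurableTypeR R := (a * x + b)%R.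
have mphi : measurable_fun setT phi by exact: measurable_affine.
pose m := measure_function_pushforward__canonical__measure_function_Measure mu mphi.
suff -> : mu A = mscale (NngNum an0) m A.
  by rewrite /mscale /= muleA -EFinM mulVf ?gt_eqF// mul1e.
apply: lebesgue_measure_unique => //=.
move=> _ [[x y]] /= _ <-; rewrite /mscale /= /pushforward.
have -> : phi @^-1` `]x, y]%classic = `]((x - b) / a)%R, ((y - b) / a)%R]%classic.
  apply/seteqP; split => z /=; rewrite !in_itv /= => /andP[h1 h2].
    by rewrite ltr_pdivrMr// ler_pdivlMr// ltrBlDr lerBrDr [(z * a)%R]mulrC h1.
  move: h1 h2; rewrite ltr_pdivrMr// ler_pdivlMr// ltrBlDr lerBrDr.
  by rewrite [(z * a)%R]mulrC => -> ->.
rewrite !lebesgue_measure_itv /= !lte_fin ltr_pM2r ?invr_gt0// ltrD2r.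
case: ifPn => // _; last by rewrite mule0.
by rewrite -!EFinB -EFinM -mulrBl opprB addrA subrK mulrC divfK// gt_eqF.
Qed.

Lemma ge0_integral_affine (a b : R) (g : measurableTypeR R -> \bar R) :
  (0 < a)%R -> measurable_fun setT g -> (forall x, 0 <= g x) ->
  \int[mu]_x g (a * x + b)%R = (a^-1)%:E * \int[mu]_x g x.
Proof.
move=> a0 mg g0.
have an0 : (0 <= a^-1)%R by rewrite invr_ge0 ltW.
have mphi := measurable_affine a b.
pose m := measure_function_pushforward__canonical__measure_function_Measure mu mphi.
transitivity (\int[m]_x g x).
  by rewrite ge0_integral_pushforward// ?preimage_setT.
rewrite -(@ge0_integral_mscale _ _ _ _ _ _ (NngNum an0))//.
by apply: eq_measure_integral => A mA _; exact: lebesgue_measure_affine.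
Qed.

End lebesgue_line.

Section lebesgue_space.
Context {R : realType}.
Local Open Scope ereal_scope.

Lemma measurable_rV_affine n (a : R) (b : 'rV[R]_n) :
  measurable_fun setT (fun v : 'rV[R]_n => (a *: v + b)%R).
Proof.
apply/measurable_fun_coordP => i; under eq_fun do rewrite !mxE.
by apply: measurable_funD => //; apply: measurable_funM => //; exact: measurable_coord.
Qed.

Lemma ge0_integral_rVS n (g : 'rV[R]_n.+1 -> \bar R) :
  measurable_fun setT g -> (forall v, 0 <= g v) ->
  \int[lebesgue_rV n.+1]_v g v =
  \int[@lebesgue_measure R]_x \int[lebesgue_rV n]_v g (cons_rV (x, v)).
Proof.
move=> mg g0.
pose m := measure_function_pushforward__canonical__measure_function_Measure
  (@lebesgue_measure R \x lebesgue_rV n) (@measurable_cons_rV R n).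
transitivity (\int[m]_v g v) => //.
rewrite ge0_integral_pushforward ?preimage_setT//; last exact: measurable_cons_rV.
rewrite fubini_tonelli1//; last by move=> z; exact: g0.
by apply: measurableT_comp => //; exact: measurable_cons_rV.
Qed.

(** Induction on the dimension: Tonelli splits off the first coordinate, and each one-dimensional
    integration contributes a factor [a^-1]. *)
Lemma ge0_integral_rV_affine n (a : R) (b : 'rV[R]_n) (g : 'rV[R]_n -> \bar R) :
  (0 < a)%R -> measurable_fun setT g -> (forall v, 0 <= g v) ->
  \int[lebesgue_rV n]_v g (a *: v + b)%R = (a ^- n)%:E * \int[lebesgue_rV n]_v g v.
Proof.
move=> a0; elim: n b g => [|n IH] b g mg g0.
  rewrite expr0 invr1 mul1e; apply: eq_integral => v _; congr g.
  by rewrite !thinmx0.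
rewrite !ge0_integral_rVS//; last first.
  by apply: measurableT_comp => //; exact: measurable_rV_affine.
pose b' : 'rV[R]_n := \row_i b ord0 (lift ord0 i).
have mc : measurable_fun setT (g \o (@cons_rV R n)).
  by apply: measurableT_comp => //; exact: measurable_cons_rV.
have E x v : (a *: cons_rV (x, v) + b)%R =
    cons_rV ((a * x + b ord0 ord0)%R, (a *: v + b')%R).
  apply/rowP => i; rewrite !mxE; case: (unliftP ord0 i) => [j|] -> //=.
  by rewrite !mxE.
under eq_integral => x _.
  under eq_integral => v _ do rewrite E.
  rewrite (IH b' (fun v => g (cons_rV ((a * x + b ord0 ord0)%R, v))))//; last first.
    by apply: (measurableT_comp mc); exact: measurable_pair1.
  over.
have mF := @measurable_fun_fubini_tonelli_F _ _ _ _ _ (lebesgue_rV n) _ mc (fun z => g0 _).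
rewrite ge0_integralZl//; last 3 first.
- by apply: (measurableT_comp mF); exact: measurable_affine.
- by move=> x _; exact: integral_ge0.
- by rewrite lee_fin invr_ge0 exprn_ge0// ltW.
rewrite (@ge0_integral_affine _ a (b ord0 ord0)
  (fun x => \int[lebesgue_rV n]_v g (cons_rV (x, v))))//.
- by rewrite muleA -EFinM exprSr invfM.
- by move=> x; exact: integral_ge0.
Qed.

(** The sigma-algebra is generated by the coordinates, so [U] is rebuilt from boxes: it is the
    countable union of the cubes inside it that have a rational centre and radius [1/(k+1)]. *)
Lemma open_measurable_rV n (U : set 'rV[R]_n) : open U -> measurable U.
Proof.
move=> oU.
pose box (i : 'rV[rat]_n * nat) : set 'rV[R]_n :=
  [set v | forall j, (v ord0 j) \in `](ratr (i.1 ord0 j) - i.2.+1%:R^-1)%R,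
                                     (ratr (i.1 ord0 j) + i.2.+1%:R^-1)%R[ ].
have mbox i : measurable (box i).
  rewrite [X in measurable X](_ : _ =
      \bigcap_(j in [set: 'I_n]) ((fun v : 'rV[R]_n => v ord0 j) @^-1`
         `](ratr (i.1 ord0 j) - i.2.+1%:R^-1)%R, (ratr (i.1 ord0 j) + i.2.+1%:R^-1)%R[)).
    apply: fin_bigcap_measurable => // j _; rewrite -[X in measurable X]setTI.
    exact: measurable_coord.
  by apply/seteqP; split => v /= Av j; [move=> _|]; exact: Av.
rewrite (_ : U = \bigcup_i (if `[< box i `<=` U >] then box i else set0)).
  apply: countable_bigcupT_measurable => // i; by case: ifP.
apply/seteqP; split => [v Uv|v [i _]]; last by case: ifPn => // /asboolP; exact.
have /nbhs_ballP[e /= e0 eU] := open_nbhs_nbhs (conj oU Uv).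
(* A cube of this radius whose centre is within one radius of [v] stays in the ball of radius [e]
   about [v]. *)
have [k ke] : exists k : nat, (2 * k.+1%:R^-1 < e)%R.
  exists (Num.trunc (2 / e)); rewrite ltr_pdivrMr// mulrC -ltr_pdivrMr//.
  by rewrite truncnS_gt.
have /choice[q qP] : forall j, exists q : rat,
    ratr q \in `](v ord0 j - k.+1%:R^-1)%R, (v ord0 j + k.+1%:R^-1)%R[.
  by move=> j; apply: rat_in_itvoo; rewrite ltrD2l gtrN// invr_gt0.
have vq j : (`|v ord0 j - ratr (q j)| < k.+1%:R^-1)%R.
  by have := qP j; rewrite in_itv /= => ?; rewrite distrC ltr_distl.
exists ((\row_j q j)%R, k) => //; case: ifPn => [_|/asboolP[]].
  by move=> j; rewrite /= mxE in_itv /= -ltr_distl vq.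
move=> w bw; apply: eU; split=> // i j; rewrite ord1 -ball_normE /ball_ /=.
have := bw j; rewrite /= mxE in_itv /= -ltr_distl => wq.
apply: lt_trans ke; rewrite mulr2n mulrDl mul1r.
by apply: le_lt_trans (ler_distD (ratr (q j)) _ _) _; rewrite ltrD// distrC.
Qed.

Lemma continuous_measurable_rV n (f : 'rV[R]_n -> R) :
  continuous f -> measurable_fun setT f.
Proof.
move=> cf; apply: (measurability _ (RGenOpens.measurableE R)).
move=> /= _ [_ [a [b ->] <-]]; rewrite setTI; apply: open_measurable_rV.
by move/continuousP : cf; apply; exact: interval_open.
Qed.
End lebesgue_space.

(** * Translations, shears and dilations in double integrals *)

Section product_changes_of_variables.
Context {R : realType} {n : nat}.
Local Open Scope ereal_scope.
Local Notation L := (@lebesgue_rV R n).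
Implicit Type G : 'rV[R]_n * 'rV[R]_n -> \bar R.

Lemma measurable_rVD d (T : measurableType d) (u v : T -> 'rV[R]_n) :
  measurable_fun setT u -> measurable_fun setT v ->
  measurable_fun setT (fun x => (u x + v x)%R).
Proof.
move=> /measurable_fun_coordP mu /measurable_fun_coordP mv.
apply/measurable_fun_coordP => i; under eq_fun do rewrite mxE.
exact: measurable_funD.
Qed.

Lemma measurable_rVZ d (T : measurableType d) (a : R) (u : T -> 'rV[R]_n) :
  measurable_fun setT u -> measurable_fun setT (fun x => (a *: u x)%R).
Proof.
move=> /measurable_fun_coordP mu.
apply/measurable_fun_coordP => i; under eq_fun do rewrite mxE.
exact: measurable_funM.
Qed.

Lemma ge0_integral_rV_translate (b : 'rV[R]_n) (g : 'rV[R]_n -> \bar R) :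
  measurable_fun setT g -> (forall v, 0 <= g v) ->
  \int[L]_v g (v + b)%R = \int[L]_v g v.
Proof.
move=> mg g0; under eq_integral do rewrite -[X in (X + b)%R]scale1r.
by rewrite ge0_integral_rV_affine// expr1n invr1 mul1e.
Qed.

(** For fixed [z.2] this is a translation in [z.1], hence the choice of the order of integration. *)
Lemma ge0_integral_shear1 G :
  measurable_fun setT G -> (forall z, 0 <= G z) ->
  \int[L \x L]_z G ((z.1 + z.2)%R, z.2) = \int[L \x L]_z G z.
Proof.
move=> mG G0; rewrite fubini_tonelli2//; last first.
  by apply: (measurableT_comp mG); apply: measurable_fun_pair => //; exact: measurable_rVD.
rewrite [RHS](fubini_tonelli2 _ mG G0).
apply: eq_integral => h _; rewrite /fubini_G /=.
rewrite (ge0_integral_rV_translate h (fun x => G (x, h)))//.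
by apply: (measurableT_comp mG); exact: measurable_pair2.
Qed.

(** This passes between pairs of points and the coordinates [(x, h)] of a point and a
    displacement. *)
Lemma ge0_integral_shear2 G :
  measurable_fun setT G -> (forall z, 0 <= G z) ->
  \int[L \x L]_z G (z.1, (z.1 + z.2)%R) = \int[L \x L]_z G z.
Proof.
move=> mG G0; rewrite fubini_tonelli1//; last first.
  by apply: (measurableT_comp mG); apply: measurable_fun_pair => //; exact: measurable_rVD.
rewrite [RHS](fubini_tonelli1 _ mG G0).
apply: eq_integral => x _; rewrite /fubini_F /=.
under eq_integral do rewrite addrC.
rewrite (ge0_integral_rV_translate x (fun y => G (x, y)))//.
by apply: (measurableT_comp mG); exact: measurable_pair1.
Qed.

Lemma ge0_integral_scale2 (a : R) G : (0 < a)%R ->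
  measurable_fun setT G -> (forall z, 0 <= G z) ->
  \int[L \x L]_z G (z.1, (a *: z.2)%R) = (a ^- n)%:E * \int[L \x L]_z G z.
Proof.
move=> a0 mG G0; rewrite fubini_tonelli1//; last first.
  by apply: (measurableT_comp mG); apply: measurable_fun_pair => //; exact: measurable_rVZ.
rewrite [in RHS](fubini_tonelli1 _ mG G0).
rewrite -ge0_integralZl//; last 3 first.
- exact: measurable_fun_fubini_tonelli_F.
- by move=> x _; exact: integral_ge0.
- by rewrite lee_fin invr_ge0 exprn_ge0// ltW.
apply: eq_integral => x _; rewrite /fubini_F /=.
under eq_integral do rewrite -[(_ *: _)%R]addr0.
rewrite (@ge0_integral_rV_affine _ _ a 0%R (fun y => G (x, y)))//.
by apply: (measurableT_comp mG); exact: measurable_pair1.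
Qed.

End product_changes_of_variables.

(** * The fractional Hardy inequality *)

(** Either [b <= d * a], and then [a + b <= (1 + d) * a], or [d * a < b], and then
    [a + b <= (1 + d^-1) * b]. A small [d] brings the factor of [a] close to 1. *)
Lemma powRD_le_weighted {R : realType} (a b d p : R) :
  0 <= a -> 0 <= b -> 0 < d -> 0 <= p ->
  (a + b) `^ p <= (1 + d) `^ p * a `^ p + (1 + d^-1) `^ p * b `^ p.
Proof.
move=> a0 b0 d0 p0; have i0 : 0 < d^-1 by rewrite invr_gt0.
have d1 : 0 <= 1 + d by rewrite addr_ge0// ltW.
have i1 : 0 <= 1 + d^-1 by rewrite addr_ge0// ltW.
rewrite -!powRM//.
have [h|h] := leP b (d * a).
  apply: (@le_trans _ _ (((1 + d) * a) `^ p)); last by rewrite lerDl powR_ge0.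
  by apply: ge0_ler_powR; rewrite ?nnegrE ?addr_ge0 ?mulr_ge0// mulrDl mul1r lerD2l.
apply: (@le_trans _ _ (((1 + d^-1) * b) `^ p)); last by rewrite lerDr powR_ge0.
apply: ge0_ler_powR; rewrite ?nnegrE ?addr_ge0 ?mulr_ge0//.
by rewrite mulrDl mul1r addrC lerD2l mulrC ler_pdivlMr// mulrC ltW.
Qed.

Lemma measurable_fun_powR {R : realType} d (T : measurableType d) (g : T -> R) (r : R) :
  measurable_fun setT g -> measurable_fun setT (fun x => g x `^ r).
Proof. by move=> mg; exact: (measurableT_comp (measurable_powR r) mg). Qed.

Lemma measurable_fun_normr {R : realType} d (T : measurableType d) (g : T -> R) :
  measurable_fun setT g -> measurable_fun setT (fun x => `|g x|).
Proof. by move=> mg; exact: (measurableT_comp _ mg). Qed.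

Lemma powR_gt1 {R : realType} (a x : R) : 1 < a -> 0 < x -> 1 < a `^ x.
Proof.
move=> a1 x0; have := @gt0_ltr_powR _ _ x0 1 a.
by rewrite !nnegrE powR1 (le_trans ler01 (ltW a1)); exact.
Qed.

Section hardy.
Context {R : realType} {n : nat}.
Variables (p al : R) (Om : set 'rV[R]_n) (f : 'rV[R]_n -> R).
Hypotheses (p0 : 0 < p) (mOm : measurable Om)
  (mf : measurable_fun setT f) (f0 : forall x, ~ Om x -> f x = 0).
Local Notation L := (@lebesgue_rV R n).
Local Notation s := (n%:R + al).

(* [0 `^ (- s)] is [0], so the kernel vanishes on the diagonal [h = 0]. *)
Definition kernel (M : R) (h : 'rV[R]_n) : R :=
  if `|h| <= M then `|h| `^ (- s) else 0.

(** Here [z] is a point [x] together with a displacement [h], so that halving the segment from [x]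
    to [x + h] is a dilation in the second variable. *)
Definition exterior_energy (M : R) (z : 'rV[R]_n * 'rV[R]_n) : R :=
  kernel M z.2 * (`|f z.1| `^ p * \1_(~` Om) (z.1 + z.2)).

(** There is no cut-off here: this integral may be infinite, and the estimates are then trivial. *)
Definition interior_energy (z : 'rV[R]_n * 'rV[R]_n) : R :=
  `|z.2| `^ (- s) *
  (\1_Om z.1 * \1_Om (z.1 + z.2) * `|f z.1 - f (z.1 + z.2)| `^ p).

Lemma kernel_ge0 M h : 0 <= kernel M h.
Proof. by rewrite /kernel; case: ifP => // _; exact: powR_ge0. Qed.

Lemma exterior_energy_ge0 M z : 0 <= exterior_energy M z.
Proof. by rewrite mulr_ge0 ?kernel_ge0// mulr_ge0 ?powR_ge0. Qed.

Lemma interior_energy_ge0 z : 0 <= interior_energy z.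
Proof. by rewrite mulr_ge0 ?powR_ge0// mulr_ge0 ?powR_ge0// mulr_ge0. Qed.

Lemma measurable_norm_rV : measurable_fun setT (fun h : 'rV[R]_n => `|h|).
Proof. by apply: continuous_measurable_rV; exact: norm_continuous. Qed.

Lemma measurable_kernel M : measurable_fun setT (kernel M).
Proof.
apply: measurable_fun_ifT => //.
- by apply: measurable_fun_ler => //; exact: measurable_norm_rV.
- by apply: measurable_fun_powR; exact: measurable_norm_rV.
Qed.

Lemma measurable_rV_sum :
  measurable_fun setT (fun z : 'rV[R]_n * 'rV[R]_n => z.1 + z.2).
Proof. exact: measurable_rVD. Qed.

Lemma measurable_exterior_energy M : measurable_fun setT (exterior_energy M).
Proof.
apply: measurable_funM; first exact: (measurableT_comp (measurable_kernel M)).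
apply: measurable_funM.
  apply: measurable_fun_powR.
  by apply: (measurableT_comp (@normr_measurable _ _)); exact: (measurableT_comp mf).
apply: (measurableT_comp _ measurable_rV_sum).
by apply: measurable_indic; exact: measurableC.
Qed.

Lemma measurable_interior_energy : measurable_fun setT interior_energy.
Proof.
apply: measurable_funM.
  apply: measurable_fun_powR.
  exact: (measurableT_comp measurable_norm_rV).
apply: measurable_funM.
  apply: measurable_funM.
    by apply: (measurableT_comp _ measurable_fst); exact: measurable_indic.
  by apply: (measurableT_comp _ measurable_rV_sum); exact: measurable_indic.
apply: measurable_fun_powR.
apply: measurable_fun_normr.
apply: measurable_funB; first exact: (measurableT_comp mf).
exact: (measurableT_comp mf measurable_rV_sum).
Qed.

Let half (h : 'rV[R]_n) := 2^-1 *: h.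

(** Without the cut-off this is an equality, by homogeneity. The cut-off acts in the right
    direction, since [half h] is within it whenever [h] is. *)
Lemma kernel_half M h : kernel M h <= 2 `^ (- s) * kernel M (half h).
Proof.
rewrite /kernel /half normrZ ger0_norm ?invr_ge0//.
have [h1|h1] := leP `|h| M; last by case: ifP => // _; rewrite mulr0 // mulr_ge0 ?powR_ge0.
rewrite ifT; last by rewrite (le_trans _ h1)// ler_piMl// invf_le1// ler1n.
by rewrite -powRM// ?mulrA ?mulfV ?mul1r// mulr_ge0// invr_ge0.
Qed.

(* The segment from [x] to [x + h] is halved at [x + half h], from which the
   same step [half h] again leaves [Om]. *)
Lemma exterior_energy_half M d x h : 0 < d ->
  exterior_energy M (x, h) <= 2 `^ (- s) *
    (exterior_energy M (x, half h)
     + (1 + d) `^ p * exterior_energy M (x + half h, half h)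
     + (1 + d^-1) `^ p * interior_energy (x, half h)).
Proof.
move=> d0; rewrite /exterior_energy /interior_energy /=.
have -> : x + half h + half h = x + h.
  by rewrite -addrA -scalerDl -mulr2n -(mulr_natr 2^-1) mulVf// scale1r.
set k := kernel M (half h); set y := x + half h.
have k0 : 0 <= k by exact: kernel_ge0.
have s0 : 0 <= (2 : R) `^ (- s) by exact: powR_ge0.
have RHS0 : 0 <= k * (`|f x| `^ p * \1_(~` Om) y) by rewrite !mulr_ge0 ?powR_ge0.
have [xhO|xhO] := pselect (Om (x + h)).
  rewrite [X in `|f x| `^ p * X]indicE memNset ?mulr0; last by move=> /(_ xhO).
  by rewrite !(mulr_ge0,addr_ge0,powR_ge0).
rewrite [X in `|f x| `^ p * X]indicE mem_set// mulr1.
apply: (@le_trans _ _ (2 `^ (- s) * k * `|f x| `^ p)).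
  by rewrite ler_wpM2r ?powR_ge0// kernel_half.
rewrite -[leLHS]mulrA ler_wpM2l//.
(* If [y] is outside [Om], the first term on the right already suffices. *)
have [yO|yO] := pselect (Om y); last first.
  rewrite [X in `|f x| `^ p * X]indicE mem_set// mulr1 -addrA lerDl.
  by rewrite !(mulr_ge0,addr_ge0,powR_ge0).
have [xO|xO] := pselect (Om x); last first.
  rewrite f0// normr0 powR0 ?gt_eqF// mulr0.
  by rewrite !(mulr_ge0,addr_ge0,powR_ge0).
(* Now [x] and [y] are inside: write [f x] as [f y] plus the difference. The exterior energy at [y]
   pays for [f y], the interior energy at [x] for the difference. *)
rewrite [X in `|f y| `^ p * X]indicE mem_set// mulr1.
rewrite [\1_Om x]indicE [\1_Om y]indicE !mem_set// !mul1r.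
rewrite -[leLHS]add0r -addrA lerD//.
apply: (@le_trans _ _ (k * ((1 + d) `^ p * `|f y| `^ p
    + (1 + d^-1) `^ p * `|f x - f y| `^ p))).
  rewrite ler_wpM2l//.
  have := powRD_le_weighted _ _ _ _ (normr_ge0 (f y)) (normr_ge0 (f x - f y)) d0 (ltW p0).
  apply: le_trans.
  apply: ge0_ler_powR; rewrite ?nnegrE ?addr_ge0//; first exact: ltW.
  by have := ler_normD (f y) (f x - f y); rewrite subrKC.
rewrite mulrDr mulrCA lerD2l mulrCA ler_wpM2l ?powR_ge0// ler_wpM2r ?powR_ge0//.
by rewrite /k /kernel; case: ifP => // _; exact: powR_ge0.
Qed.


(** The pointwise bound is integrated. Replacing [half h] by [h] costs [2^n], which turns [2^(-s)]
    into [2^(-al)], and a shear identifies the term based at the midpoint with the original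
    integral. *)
Lemma exterior_energy_le M d : 0 < d ->
  (\int[L \x L]_z (exterior_energy M z)%:E <= (2 `^ (- al))%:E *
    ((1 + (1 + d) `^ p)%:E * \int[L \x L]_z (exterior_energy M z)%:E
     + ((1 + d^-1) `^ p)%:E * \int[L \x L]_z (interior_energy z)%:E))%E.
Proof.
move=> d0.
have mA := measurable_exterior_energy M.
have mB := measurable_interior_energy.
have mS : measurable_fun setT
    (fun z : 'rV[R]_n * 'rV[R]_n => exterior_energy M (z.1 + z.2, z.2)).
  by apply: (measurableT_comp mA); apply: measurable_fun_pair => //; exact: measurable_rV_sum.
pose G (z : 'rV[R]_n * 'rV[R]_n) : R := 2 `^ (- s) *
    (exterior_energy M z + (1 + d) `^ p * exterior_energy M (z.1 + z.2, z.2)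
     + (1 + d^-1) `^ p * interior_energy z).
have mG : measurable_fun setT G.
  apply: measurable_funM => //; apply: measurable_funD; last exact: measurable_funM.
  by apply: measurable_funD => //; exact: measurable_funM.
have G0 z : 0 <= G z.
  have A0 := exterior_energy_ge0 M; have B0 := interior_energy_ge0.
  rewrite mulr_ge0 ?powR_ge0// addr_ge0//; last by rewrite mulr_ge0 ?powR_ge0.
  by rewrite addr_ge0// mulr_ge0 ?powR_ge0.
have hh : 0 < (2^-1 : R) by rewrite invr_gt0.
apply: (@le_trans _ _ (\int[L \x L]_z (G (z.1, half z.2))%:E)%E).
  apply: ge0_le_integral => //.
  - by move=> z _; rewrite lee_fin exterior_energy_ge0.
  - exact/measurable_EFinP.
  - apply/measurable_EFinP; apply: (measurableT_comp mG).
    by apply: measurable_fun_pair => //; exact: measurable_rVZ.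
  - by move=> [x h] _; rewrite lee_fin; exact: exterior_energy_half.
rewrite (@ge0_integral_scale2 _ _ 2^-1 (EFin \o G))//; last exact/measurable_EFinP.
rewrite exprVn invrK /G.
under eq_integral do
  rewrite /= EFinM EFinD EFinD (EFinM ((1 + d) `^ p)) (EFinM ((1 + d^-1) `^ p)).
have mA' : measurable_fun setT (EFin \o exterior_energy M) by exact/measurable_EFinP.
have mB' : measurable_fun setT (EFin \o interior_energy) by exact/measurable_EFinP.
have mS' := measurableT_comp (@EFin_measurable R setT) mS.
have A0 z : (0 <= (exterior_energy M z)%:E)%E by rewrite lee_fin exterior_energy_ge0.
have B0 z : (0 <= (interior_energy z)%:E)%E by rewrite lee_fin interior_energy_ge0.
have P0 a b : (0 <= (a `^ b : R)%:E)%E by rewrite lee_fin powR_ge0.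
have mS2 := measurable_funeM ((1 + d) `^ p)%:E mS'.
have mB2 := measurable_funeM ((1 + d^-1) `^ p)%:E mB'.
have mAS := emeasurable_funD mA' mS2.
have S0 z : (0 <= ((1 + d) `^ p)%:E * (exterior_energy M (z.1 + z.2, z.2))%:E)%E.
  by apply: mule_ge0.
have B20 z : (0 <= ((1 + d^-1) `^ p)%:E * (interior_energy z)%:E)%E by apply: mule_ge0.
have AS0 z : (0 <= (exterior_energy M z)%:E +
  ((1 + d) `^ p)%:E * (exterior_energy M (z.1 + z.2, z.2))%:E)%E by apply: adde_ge0.
rewrite ge0_integralZl//; last 2 first.
- exact: emeasurable_funD.
- by move=> z _; apply: adde_ge0.
rewrite ge0_integralD//.
rewrite ge0_integralD//.
rewrite [X in (_ + X + _)%E]ge0_integralZl//.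
rewrite [X in (_ + X)%E]ge0_integralZl//.
rewrite (@ge0_integral_shear1 _ _ (EFin \o exterior_energy M))//.
rewrite muleA -EFinM; apply: lee_pmul => //.
- by apply: adde_ge0; [apply: adde_ge0; [|apply: mule_ge0 => //]|apply: mule_ge0 => //];
    apply: integral_ge0 => z _; rewrite ?A0 ?B0//; exact: A0.
- rewrite lee_fin opprD powRD ?pnatr_eq0 ?implybT// (powRN 2 n%:R) powR_mulrn//.
  by rewrite mulrA mulfV ?mul1r// expf_neq0// pnatr_eq0.
- by rewrite EFinD ge0_muleDl ?mul1e.
Qed.

End hardy.

(** The constant is fixed before [n], [Om], [f] and [M], so the cut-off may later depend on [f].
    Finiteness is what allows the exterior integral to be absorbed. *)
Lemma fractional_hardy {R : realType} (p al : R) : 0 < p -> 1 < al ->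
  exists2 K : R, 0 < K &
    forall (n : nat) (Om : set 'rV[R]_n) (f : 'rV[R]_n -> R) (M : R),
      measurable Om -> measurable_fun setT f -> (forall x, ~ Om x -> f x = 0) ->
      (\int[lebesgue_rV n \x lebesgue_rV n]_z (exterior_energy p al Om f M z)%:E < +oo)%E ->
      (\int[lebesgue_rV n \x lebesgue_rV n]_z (exterior_energy p al Om f M z)%:E <=
       K%:E * \int[lebesgue_rV n \x lebesgue_rV n]_z (interior_energy p al Om f z)%:E)%E.
Proof.
move=> p0 al1.
pose e : R := 2 `^ (al - 1); pose d : R := 2 `^ ((al - 1) / p) - 1.
have d0 : 0 < d by rewrite subr_gt0 powR_gt1 ?ltr1n// divr_gt0// subr_gt0.
have de : (1 + d) `^ p = e by rewrite /d subrKC -powRrM divfK// gt_eqF.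
pose q : R := 2 `^ (- al); pose C := (1 + d^-1) `^ p.
have q0 : 0 < q by exact: powR_gt0.
have qe : q * e = 2^-1.
  by rewrite /q /e -powRD ?pnatr_eq0 ?implybT// addrA addNr sub0r powR_inv1.
have q2 : q < 2^-1 by rewrite -qe ltr_pMr// powR_gt1 ?ltr1n// subr_gt0.
have C0 : 0 < C by rewrite powR_gt0// addr_gt0// invr_gt0.
(* This solves [I <= (q + 1/2) * I + q * C * J] for [I]; the denominator is positive because
   [al > 1]. *)
exists (q * C / (2^-1 - q)); first by rewrite divr_gt0 ?mulr_gt0// subr_gt0.
move=> n Om f M mOm mf f0; set I := (\int[_]_z _)%E; set J := (\int[_]_z _)%E => Ioo.
have I0 : (0 <= I)%E by apply: integral_ge0 => z _; rewrite lee_fin exterior_energy_ge0.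
have J0 : (0 <= J)%E by apply: integral_ge0 => z _; rewrite lee_fin interior_energy_ge0.
have := exterior_energy_le p al Om f p0 mOm mf f0 M d d0.
rewrite -/I -/J -/q -/C de.
have [->|Joo] := eqVneq J +oo%E.
  by move=> _; rewrite gt0_muley ?leey// lte_fin divr_gt0 ?mulr_gt0// subr_gt0.
rewrite -(fineK (x := I)) ?ge0_fin_numE// -(fineK (x := J)) ?ge0_fin_numE ?ltey//.
move: (fine I) (fine J) => i j; rewrite -!(EFinM,EFinD) !lee_fin => h.
rewrite mulrAC ler_pdivlMr ?subr_gt0//.
have E : q * ((1 + e) * i + C * j) = q * i + (q * e) * i + q * C * j by ring.
move: h; rewrite E qe; lra.
Qed.

(** * The fractional Sobolev inequality *)

Lemma powR_le {R : realType} (r x y : R) :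
  0 <= r -> 0 <= x -> x <= y -> x `^ r <= y `^ r.
Proof.
move=> r0 x0 xy.
by apply: (@ge0_ler_powR _ _ r0); rewrite ?nnegrE// (le_trans x0).
Qed.

Section sobolev.
Context {R : realType} {n : nat}.
Local Notation L := (@lebesgue_rV R n).

Lemma norm_rV_leP (h : 'rV[R]_n) (r : R) : 0 <= r ->
  reflect (forall i, `|h ord0 i| <= r) (`|h| <= r).
Proof.
move=> r0; rewrite [`|h|]mx_normrE; apply: (iffP (bigmax_leP _ _ _ _)) => [[_ H] i|H].
  exact: (H (ord0, i)).
by split=> // -[i j] _ /=; rewrite ord1.
Qed.

Lemma lebesgue_rV_cube (r : R) : 0 <= r ->
  L [set h | `|h| <= r] = ((2 * r) ^+ n)%:E.
Proof.
move=> r0.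
have -> : [set h : 'rV[R]_n | `|h| <= r] =
    [set h | forall i, `[- r, r]%classic (h ord0 i)].
  apply/seteqP; split => h /=.
    by move=> /(norm_rV_leP _ _ r0) H i; rewrite /= in_itv /= -ler_norml.
  by move=> H; apply/norm_rV_leP => // i; have := H i; rewrite /= in_itv /= -ler_norml.
rewrite (@lebesgue_rV_box R n (fun=> `[- r, r]%classic))//.
rewrite (eq_bigr (fun=> (2 * r)%:E)); last first.
  move=> i _; rewrite lebesgue_measure_itv /= lte_fin.
  have [->|rn] := eqVneq r 0; first by rewrite oppr0 ltxx mulr0.
  by rewrite gtrN ?lt_def ?rn// -EFinB opprK mulr2n mulrDl mul1r.
by rewrite prodEFin prodr_const card_ord.
Qed.

Lemma measurable_cube (r : R) : measurable [set h : 'rV[R]_n | `|h| <= r].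
Proof.
rewrite [X in measurable X](_ : _ =
    setT `&` (fun h : 'rV[R]_n => `|h|) @^-1` `]-oo, r]%classic).
  by apply: measurable_norm_rV => //; exact: measurable_itv.
by rewrite setTI; apply/seteqP; split => h /=; rewrite in_itv.
Qed.

Variables (p al : R) (f : 'rV[R]_n -> R) (S : R).
Hypotheses (n0 : (0 < n)%N) (p0 : 0 < p) (al0 : 0 < al) (aln : al < n%:R)
  (mf : measurable_fun setT f).
Local Notation s := (n%:R + al).
Local Notation q := (n%:R * p / (n%:R - al)).
Hypotheses (S0 : 0 < S) (fS : (\int[L]_y (`|f y| `^ q)%:E = S%:E)%E).

Let nal0 : 0 < n%:R - al. Proof. by rewrite subr_gt0. Qed.
Let nR0 : 0 < n%:R :> R. Proof. by rewrite ltr0n. Qed.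
Let q0 : 0 < q. Proof. by rewrite divr_gt0 ?mulr_gt0. Qed.

(* By Markov's inequality, [level_mass t] bounds the measure of [|f| > t / 2];
   the cube of sup-norm radius [level_radius t] has twice that measure. *)
Definition level_mass (t : R) : R := 2 `^ q * S / t `^ q.
Definition level_radius (t : R) : R := (2 * level_mass t) `^ n%:R^-1 / 2.

Lemma level_mass_gt0 t : 0 < t -> 0 < level_mass t.
Proof. by move=> t0; apply: divr_gt0; [apply: mulr_gt0|]; rewrite ?powR_gt0. Qed.

Lemma level_radius_gt0 t : 0 < t -> 0 < level_radius t.
Proof.
by move=> t0; apply: divr_gt0 => //; apply: powR_gt0; rewrite mulr_gt0 ?level_mass_gt0.
Qed.

(** By monotonicity, a cut-off at the radius of one level serves all higher levels. *)
Lemma level_radius_le t u : 0 < t -> t <= u -> level_radius u <= level_radius t.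
Proof.
move=> t0 tu; have u0 := lt_le_trans t0 tu.
rewrite /level_radius ler_pM2r; last by rewrite invr_gt0.
apply: powR_le; first by rewrite invr_ge0.
  by apply: mulr_ge0 => //; exact/ltW/level_mass_gt0.
rewrite ler_pM2l; last by [].
rewrite /level_mass ler_pM2l; last by rewrite mulr_gt0 ?powR_gt0.
by rewrite lef_pV2 ?posrE ?powR_gt0 ?powR_le// ltW.
Qed.

Lemma measurable_translate (x : 'rV[R]_n) : measurable_fun setT (fun h => f (x + h)).
Proof. by apply: (measurableT_comp mf); exact: measurable_rVD. Qed.

Let above x := [set h | `|f x| / 2 < `|f (x + h)|].

Let measurable_above x : measurable (above x).
Proof.
rewrite [X in measurable X](_ : _ =
    setT `&` (fun h => `|f (x + h)|) @^-1` `]`|f x| / 2, +oo[%classic).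
  apply: (measurable_fun_normr _ _ _ (measurable_translate x)) => //.
by rewrite setTI; apply/seteqP; split => h /=; rewrite in_itv /= andbT.
Qed.

(** Markov's inequality for the [q]-th power of [|f|], after translating the integral [S] by [x]. *)
Lemma lebesgue_above x : f x != 0 -> (L (above x) <= (level_mass `|f x|)%:E)%E.
Proof.
move=> fx; have t0 : 0 < `|f x| by rewrite normr_gt0.
set t := `|f x| in t0 *.
have t20 : 0 < (t / 2) `^ q by rewrite powR_gt0// divr_gt0.
have mp : measurable_fun setT (fun h => `|f (x + h)| `^ q).
  by apply: measurable_fun_powR; apply: measurable_fun_normr; exact: measurable_translate.
have H : (((t / 2) `^ q)%:E * L (above x) <= S%:E)%E.
  rewrite -fS -(@ge0_integral_rV_translate _ _ x (fun y => (`|f y| `^ q)%:E)); last 2 first.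
  - by apply/measurable_EFinP; apply: measurable_fun_powR; exact: measurable_fun_normr.
  - by move=> y; rewrite lee_fin powR_ge0.
  under eq_integral do rewrite addrC.
  rewrite -[above x]setIT -integral_indic// -ge0_integralZl_EFin//; last 2 first.
  - by apply/measurable_EFinP; exact: measurable_indic.
  - exact: ltW.
  apply: ge0_le_integral => //.
  - by move=> h _; rewrite mule_ge0 ?lee_fin// ltW.
  - by apply: measurable_funeM; apply/measurable_EFinP; exact: measurable_indic.
  - exact/measurable_EFinP.
  move=> h _; rewrite -EFinM lee_fin indicE.
  have [/set_mem hE|_] := boolP (h \in above x); last by rewrite mulr0 powR_ge0.
  by rewrite mulr1; apply: powR_le; [exact: ltW|rewrite divr_ge0//; exact: ltW|exact: ltW].
rewrite (_ : level_mass t = S / (t / 2) `^ q); last first.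
  rewrite /level_mass powRM ?invr_ge0 ?ltW// -(powR_inv1 (ler0n _ 2)) -powRrM.
  rewrite mulN1r powRN invfM invrK; ring.
by rewrite EFinM muleC lee_pdivlMl.
Qed.

(** The integral is restricted to the part of the cube [Q] of radius [r] outside [above x]. This
    part has measure at least [m], the kernel is at least [r^(-s)] on it, and the increment of [f]
    is at least [t / 2]. *)
Lemma sobolev_pointwise M x : f x != 0 -> level_radius `|f x| <= M ->
  ((level_radius `|f x| `^ (- s) * (`|f x| / 2) `^ p * level_mass `|f x|)%:E <=
   \int[L]_h (kernel al M h * `|f x - f (x + h)| `^ p)%:E)%E.
Proof.
move=> fx rM; have t0 : 0 < `|f x| by rewrite normr_gt0.
set t := `|f x| in t0 rM *; set r := level_radius t in rM *.
have r0 : 0 < r by exact: level_radius_gt0.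
have m0 := level_mass_gt0 _ t0; set m := level_mass t in m0 *.
pose Q := [set h : 'rV[R]_n | `|h| <= r].
have mQ : measurable Q by exact: measurable_cube.
have mE := measurable_above x.
have LQ : L Q = (m + m)%:E.
  rewrite /Q lebesgue_rV_cube ?ltW// /r /level_radius mulrC divfK//.
  rewrite -powR_mulrn ?powR_ge0// -powRrM mulVf ?gt_eqF// powRr1;
    last by rewrite pmulr_rge0// ltW.
  by rewrite mulr2n mulrDl mul1r.
(* [Q] has measure [2m], and [above x] takes away at most [m]. *)
have LD : (m%:E <= L (Q `\` above x))%E.
  rewrite -(@leeD2rE _ m%:E)// -EFinD -LQ (measureDI L mQ mE) leeD2l//.
  apply: (@le_trans _ _ (L (above x))); last exact: lebesgue_above.
  by apply: le_measure; rewrite ?inE//; exact: measurableI.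
set c := r `^ (- s) * (t / 2) `^ p.
have c0 : 0 <= c by rewrite mulr_ge0 ?powR_ge0.
have mD : measurable (Q `\` above x) by exact: measurableD.
rewrite EFinM; apply: (@le_trans _ _ (c%:E * L (Q `\` above x))%E).
  by rewrite lee_wpmul2l// lee_fin.
rewrite -[Q `\` _]setIT -integral_indic// -ge0_integralZl_EFin//; last first.
- by apply/measurable_EFinP; exact: measurable_indic.
apply: ge0_le_integral => //.
- by move=> h _; rewrite mule_ge0 ?lee_fin.
- by apply: measurable_funeM; apply/measurable_EFinP; exact: measurable_indic.
- apply/measurable_EFinP; apply: measurable_funM; first exact: measurable_kernel.
  apply: measurable_fun_powR; apply: measurable_fun_normr; apply: measurable_funB => //.
  exact: measurable_translate.
move=> h _; rewrite -EFinM lee_fin indicE.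
have [/set_mem[hQ /negP hE]|_] := boolP (h \in _);
  last by rewrite mulr0 mulr_ge0 ?kernel_ge0 ?powR_ge0.
rewrite -leNgt -/t in hE.
(* The kernel is 0 at [h = 0], so this point must be excluded: there [hE] would read
   [t <= t / 2]. *)
have h0 : 0 < `|h|.
  rewrite normr_gt0; apply/eqP => h0; move: hE; rewrite h0 addr0 -/t.
  by rewrite leNgt ltr_pdivrMr// ltr_pMr// ltr1n.
rewrite mulr1 ler_pM ?powR_ge0//.
  rewrite /kernel ifT ?(le_trans hQ)// !powRN lef_pV2 ?posrE ?powR_gt0//.
  by apply: powR_le => //; rewrite addr_ge0// ltW.
apply: powR_le; [exact: ltW|rewrite divr_ge0//; exact: ltW|].
have := lerB_dist (f x) (f (x + h)); rewrite -/t; lra.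
Qed.

(** The exponent collects the powers of 2 that come from the radius, from [t / 2] and from the
    Markov bound. *)
Definition sobolev_cst : R :=
  2 `^ (s - p - s / n%:R - q * (al / n%:R)).

(** The powers of [level_mass t] combine to the exponent [1 - s/n = - al/n], and those of [t] to
    [p + q * al/n], which equals [q] by the choice of [q]. *)
Lemma level_value t : 0 < t ->
  level_radius t `^ (- s) * (t / 2) `^ p * level_mass t =
  sobolev_cst * S `^ (- (al / n%:R)) * t `^ q.
Proof.
move=> t0.
have m0 := level_mass_gt0 _ t0.
(* With every power written as an exponential, the identity becomes linear in the logarithms of 2,
   [S] and [t]. *)
have P (x y : R) : 0 < x -> x `^ y = expR (y * ln x).
  by move=> x0; rewrite /powR (gt_eqF x0).
have l2 : ln (t / 2) = ln t - ln 2 by rewrite ln_div ?posrE.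
have lm : ln (level_mass t) = q * ln 2 + ln S - q * ln t.
  by rewrite /level_mass ln_div ?lnM ?ln_powR// ?posrE ?mulr_gt0 ?powR_gt0.
have lr : ln (level_radius t) = n%:R^-1 * (ln 2 + ln (level_mass t)) - ln 2.
  have m2 : 0 < 2 * level_mass t by rewrite pmulr_rgt0.
  by rewrite /level_radius ln_div ?posrE ?powR_gt0// ln_powR lnM ?posrE.
have r0 := level_radius_gt0 _ t0.
have t2 : 0 < t / 2 by exact: divr_gt0.
have s2 : 0 < (2 : R) by [].
have em : level_mass t = expR (ln (level_mass t)) by rewrite lnK ?posrE.
rewrite (P _ _ r0) (P _ _ t2) /sobolev_cst (P _ _ s2) (P _ _ S0) (P _ _ t0).
rewrite em -!expRD lr lm l2; congr expR.
field.
by rewrite ?gt_eqF.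
Qed.

End sobolev.

(** * Finiteness of the integrals for compactly supported functions *)

Section compact_support.
Context {R : realType} {n : nat}.
Local Notation L := (@lebesgue_rV R n).
Variables (p al : R) (Om : set 'rV[R]_n) (f : 'rV[R]_n -> R).
Hypotheses (oOm : open Om) (cf : continuous f) (kf : compact (supp f)) (fOm : supp f `<=` Om).
Local Notation s := (n%:R + al).

Lemma supp_neq0 x : f x != 0 -> supp f x.
Proof. by move=> fx; exact: subset_closure. Qed.

(** Compactness makes the distance from the support to the complement of [Om] uniformly positive. *)
Lemma supp_thick : exists2 d : R, 0 < d & forall x h, supp f x -> `|h| < d -> Om (x + h).
Proof.
have /compact_near_coveringP/(_ _ (nbhs (0 : 'rV[R]_n)) (fun h x => Om (x + h)) _) := kf.
move=> /(_ _)/wrap[x fx|/nbhs_ballP[d /= d0 H]].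
  have : nbhs (x + 0) Om by rewrite addr0; apply: open_nbhs_nbhs; split => //; exact: fOm.
  by move=> /(@add_continuous _ (x, 0)).
exists d => // x h fx hd; apply: (H h) => //.
by rewrite -ball_normE /ball_ /= sub0r normrN.
Qed.

Lemma compact_supp_bounded : exists2 N : R, 0 < N & forall x, f x != 0 -> `|x| <= N.
Proof.
have /pinfty_ex_gt0[N N0 H] := compact_bounded kf.
by exists N => // x /supp_neq0/H.
Qed.

Lemma continuous_supp_bounded : exists2 B : R, 0 < B & forall x, `|f x| <= B.
Proof.
have : compact (f @` supp f) by apply: continuous_compact => //; exact: continuous_subspaceT.
move=> /compact_bounded/pinfty_ex_gt0[B B0 H]; exists B => // x.
have [->|fx] := eqVneq (f x) 0; first by rewrite normr0 ltW.
by apply: H; exists x => //; exact: supp_neq0.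
Qed.

Let mf : measurable_fun setT f. Proof. exact: continuous_measurable_rV. Qed.

Lemma integral_powR_lty q : 0 < q -> (\int[L]_x (`|f x| `^ q)%:E < +oo)%E.
Proof.
move=> q0; have [N N0 HN] := compact_supp_bounded; have [B B0 HB] := continuous_supp_bounded.
have mN := @measurable_cube R n N.
apply: (@le_lt_trans _ _
  (\int[L]_x ((B `^ q)%:E * (\1_[set h : 'rV[R]_n | (`|h| <= N)%R] x)%:E)%E)%E).
  apply: ge0_le_integral => //.
  - by apply/measurable_EFinP; apply: measurable_fun_powR; exact: measurable_fun_normr.
  - by apply: measurable_funeM; apply/measurable_EFinP; exact: measurable_indic.
  move=> x _; rewrite -EFinM lee_fin indicE.
  have [fx|fx] := eqVneq (f x) 0; first by rewrite fx normr0 powR0 ?gt_eqF// mulr_ge0 ?powR_ge0.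
  by rewrite mem_set /= ?HN// mulr1 powR_le// ltW.
rewrite ge0_integralZl_EFin ?powR_ge0//; last by apply/measurable_EFinP; exact: measurable_indic.
rewrite integral_indic// setIT.
by rewrite [X in (_ * X)%E](lebesgue_rV_cube N (ltW N0)) -EFinM ltry.
Qed.

(** Where the integrand is nonzero, [x] lies in the support and [x + h] outside [Om], so [|h| >= d]
    and the singularity is avoided. The support bounds [x] and the cut-off bounds [h]. *)
Lemma integral_exterior_energy_lty M : 0 < p -> 0 < al -> 0 < M ->
  (\int[L \x L]_z (exterior_energy p al Om f M z)%:E < +oo)%E.
Proof.
move=> p0 al0 M0.
have [N N0 HN] := compact_supp_bounded; have [B B0 HB] := continuous_supp_bounded.
have [d d0 Hd] := supp_thick.
have s0 : 0 <= s by rewrite addr_ge0// ltW.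
pose cube r := [set h : 'rV[R]_n | `|h| <= r].
have mc r : measurable (cube r) by exact: measurable_cube.
have mcc : measurable (cube N `*` cube M) by exact: measurableX.
have mi : measurable_fun setT (fun z => (\1_(cube N `*` cube M) z : R)%:E).
  by apply/measurable_EFinP; exact: measurable_indic.
pose C := d `^ (- s) * B `^ p.
have C0 : 0 <= C by rewrite mulr_ge0 ?powR_ge0.
apply: (@le_lt_trans _ _ (\int[L \x L]_z (C%:E * (\1_(cube N `*` cube M) z)%:E)%E)%E).
  apply: ge0_le_integral => //.
  - by move=> x _; rewrite lee_fin exterior_energy_ge0.
  - by apply/measurable_EFinP; apply: measurable_exterior_energy => //; exact: open_measurable_rV.
  - exact: measurable_funeM.
  move=> [x h] _; rewrite -EFinM lee_fin /exterior_energy /=.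
  have [fx|fx] := eqVneq (f x) 0.
    by rewrite fx normr0 powR0 ?gt_eqF// mul0r mulr0 mulr_ge0.
  have [xh|xh] := pselect (Om (x + h)).
    by rewrite [X in _ * (_ * X)]indicE memNset ?mulr0; [exact: mulr_ge0|move=> /(_ xh)].
  have dh : d <= `|h| by rewrite leNgt; apply/negP => /(Hd _ _ (supp_neq0 _ fx)).
  rewrite /kernel; case: ifPn => hM; last by rewrite mul0r mulr_ge0.
  rewrite [X in _ <= _ * X]indicE mem_set ?mulr1; last by split => //=; exact: HN.
  rewrite [X in _ * (_ * X)]indicE mem_set// mulr1; apply: ler_pM; rewrite ?powR_ge0//.
    rewrite !powRN lef_pV2 ?posrE ?powR_gt0//; last exact: lt_le_trans dh.
    by apply: powR_le => //; exact: ltW.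
  by apply: powR_le => //; exact: ltW.
rewrite ge0_integralZl_EFin//.
rewrite integral_indic// setIT [X in (_ * X)%E](product_measure1E L L)//.
rewrite [X in (_ * (X * _))%E](lebesgue_rV_cube N (ltW N0)).
by rewrite [X in (_ * (_ * X))%E](lebesgue_rV_cube M (ltW M0)) -!EFinM ltry.
Qed.

End compact_support.

Lemma measurable_superlevel {R : realType} d (T : measurableType d)
    (g : T -> R) (c : R) :
  measurable_fun setT g -> measurable [set x | c <= `|g x|].
Proof.
move=> mg.
rewrite [X in measurable X](_ : _ =
    setT `&` (fun x => `|g x|) @^-1` `[c, +oo[%classic).
  by apply: (measurable_fun_normr _ _ _ mg) => //; exact: measurable_itv.
by rewrite setTI; apply/seteqP; split => x /=; rewrite in_itv /= andbT.
Qed.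

(** * The Sobolev bound integrated over a superlevel set *)

Section energy_bounds.
Context {R : realType} {n : nat}.
Local Notation L := (@lebesgue_rV R n).
Variables (p al : R) (Om : set 'rV[R]_n) (f : 'rV[R]_n -> R).
Hypotheses (n0 : (0 < n)%N) (p0 : 0 < p) (al0 : 0 < al) (aln : al < n%:R).
Hypotheses (mOm : measurable Om) (mf : measurable_fun setT f)
  (f0 : forall x, ~ Om x -> f x = 0).
Local Notation s := (n%:R + al).
Local Notation q := (n%:R * p / (n%:R - al)).

(** As [f x] is nonzero, [x] is in [Om]. If [x + h] is in [Om] the interior term dominates;
    otherwise [f (x + h) = 0] and the exterior term is equal to the left side. *)
Let split_energy M (z : 'rV[R]_n * 'rV[R]_n) : f z.1 != 0 ->
  kernel al M z.2 * `|f z.1 - f (z.1 + z.2)| `^ p <=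
  exterior_energy p al Om f M z + interior_energy p al Om f z.
Proof.
case: z => x h /= fx; rewrite /exterior_energy /interior_energy /=.
have xO : Om x by apply: contrapT => /f0/eqP; exact/negP.
have [xh|xh] := pselect (Om (x + h)).
  rewrite [X in _ * (_ * X)]indicE memNset; last by move=> /(_ xh).
  rewrite !mulr0 add0r [\1_Om x]indicE [\1_Om (x + h)]indicE !mem_set// !mul1r.
  by rewrite ler_wpM2r ?powR_ge0// /kernel; case: ifP => // _; exact: powR_ge0.
rewrite (f0 (x + h))// subr0 [X in _ * (_ * X)]indicE mem_set// mulr1 lerDl.
by rewrite mulr_ge0 ?powR_ge0// mulr_ge0 ?powR_ge0// mulr_ge0.
Qed.

(** [level_radius] is unbounded as [t] tends to 0, so only the points with [|f x| >= eta] are used;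
    a single finite cut-off [M] then serves them all. *)
Lemma sobolev_truncated (S eta M : R) : 0 < S -> 0 < eta ->
  (\int[L]_y (`|f y| `^ q)%:E = S%:E)%E ->
  @level_radius R n p al S eta <= M ->
  ((@sobolev_cst R n p al * S `^ (- (al / n%:R)))%:E *
     \int[L]_(x in [set x | (eta <= `|f x|)%R]) (`|f x| `^ q)%:E <=
   \int[L \x L]_z (exterior_energy p al Om f M z)%:E +
   \int[L \x L]_z (interior_energy p al Om f z)%:E)%E.
Proof.
move=> S0 eta0 fS rM; set V := [set x | _].
set c := sobolev_cst _ _ * _.
have c0 : 0 <= c by rewrite mulr_ge0 ?powR_ge0.
have mV : measurable V by exact: measurable_superlevel.
have mA : measurable_fun setT (EFin \o exterior_energy p al Om f M).
  by apply/measurable_EFinP; exact: measurable_exterior_energy.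
have mB : measurable_fun setT (EFin \o interior_energy p al Om f).
  by apply/measurable_EFinP; exact: measurable_interior_energy.
have A0 z : (0 <= (exterior_energy p al Om f M z)%:E)%E by rewrite lee_fin exterior_energy_ge0.
have B0 z : (0 <= (interior_energy p al Om f z)%:E)%E by rewrite lee_fin interior_energy_ge0.
rewrite -ge0_integralD// fubini_tonelli1//; last 2 first.
- exact: emeasurable_funD.
- by move=> z; exact: adde_ge0.
have mq : measurable_fun V (fun x => (`|f x| `^ q)%:E).
  apply: measurable_funTS; apply/measurable_EFinP.
  by apply: measurable_fun_powR; exact: measurable_fun_normr.
have mF : measurable_fun setT (fubini_F L
    (fun z => ((exterior_energy p al Om f M z)%:E + (interior_energy p al Om f z)%:E)%E)).
  apply: measurable_fun_fubini_tonelli_F; first exact: emeasurable_funD.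
  by move=> z; exact: adde_ge0.
have F0 x : (0 <= fubini_F L (fun z =>
    ((exterior_energy p al Om f M z)%:E + (interior_energy p al Om f z)%:E)%E) x)%E.
  by apply: integral_ge0 => h _; exact: adde_ge0.
rewrite -ge0_integralZl_EFin//.
apply: (@le_trans _ _ (\int[L]_(x in V) fubini_F L (fun z =>
    ((exterior_energy p al Om f M z)%:E + (interior_energy p al Om f z)%:E)%E) x)%E); last first.
  by apply: ge0_subset_integral.
apply: ge0_le_integral => //.
- by move=> x _; rewrite mule_ge0 ?lee_fin ?powR_ge0.
- exact: measurable_funeM.
- exact: measurable_funTS.
move=> x Vx; have t0 : 0 < `|f x| by exact: lt_le_trans Vx.
have fx : f x != 0 by rewrite -normr_gt0.
rewrite -EFinM /c -(level_value p al S n0 aln S0 _ t0).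
apply: le_trans (sobolev_pointwise p al f S n0 p0 al0 aln mf S0 fS M x fx _) _.
  by apply: le_trans rM; exact: level_radius_le.
rewrite /fubini_F; apply: ge0_le_integral => //.
- by move=> h _; rewrite lee_fin mulr_ge0 ?kernel_ge0 ?powR_ge0.
- apply/measurable_EFinP; apply: measurable_funM; first exact: measurable_kernel.
  apply: measurable_fun_powR; apply: measurable_fun_normr; apply: measurable_funB => //.
  exact: measurable_translate.
- by apply: emeasurable_funD; [apply: (measurableT_comp mA)|apply: (measurableT_comp mB)];
    exact: measurable_pair1.
- by move=> h _; rewrite -EFinD lee_fin; exact: (split_energy M (x, h)).
Qed.

End energy_bounds.

(** * Comparison of the sup norm with the Euclidean norm *)

Section euclidean_norm.
Context {R : realType} {n : nat}.
Local Notation L := (@lebesgue_rV R n).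
Implicit Type h : 'rV[R]_n.

Lemma enormN h : enorm (- h) = enorm h.
Proof. by rewrite /enorm; congr Num.sqrt; apply: eq_bigr => i _; rewrite mxE sqrrN. Qed.

Lemma norm_le_enorm h : `|h| <= enorm h.
Proof.
apply/norm_rV_leP => [|i]; first exact: sqrtr_ge0.
rewrite -sqrtr_sqr ler_sqrt; last by rewrite sumr_ge0// => j _; exact: sqr_ge0.
by rewrite (bigD1 i)//= lerDl sumr_ge0// => j _; exact: sqr_ge0.
Qed.

Lemma enorm_le h : enorm h <= Num.sqrt n%:R * `|h|.
Proof.
rewrite -[X in _ * X]ger0_norm// -sqrtr_sqr -sqrtrM// ler_sqrt ?mulr_ge0 ?sqr_ge0//.
rewrite -[n in n%:R]card_ord -sum1_card natr_sum mulr_suml; apply: ler_sum => i _.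
rewrite mul1r -real_normK ?num_real// ler_sqr ?nnegrE//.
exact: (norm_rV_leP _ _ (normr_ge0 h) (lexx _)).
Qed.

Lemma measurable_enorm : measurable_fun setT (@enorm R n).
Proof.
rewrite (_ : @enorm R n = fun h => (\sum_(i < n) h ord0 i ^+ 2) `^ 2^-1).
  apply: measurable_fun_powR; apply: measurable_sum => i.
  by apply: measurable_funX; exact: measurable_coord.
by apply/funext => h; rewrite powR12_sqrt// sumr_ge0// => i _; exact: sqr_ge0.
Qed.

(** A shear turns displacements into second points, and the Euclidean norm is at most [sqrt n] times
    the sup norm. *)
Lemma interior_energy_le_gagliardo (p al : R) (Om : set 'rV[R]_n) (f : 'rV[R]_n -> R) :
  (0 < n)%N -> 0 < al -> measurable Om -> measurable_fun setT f ->
  ((Num.sqrt n%:R `^ (- (n%:R + al)))%:E *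
     \int[L \x L]_z (interior_energy p al Om f z)%:E <=
   \int[L \x L]_(z in Om `*` Om)
     (`|f z.1 - f z.2| `^ p / enorm (z.1 - z.2) `^ (n%:R + al))%:E)%E.
Proof.
move=> n0 al0 mOm mf; set s := n%:R + al.
have s0 : 0 < s by rewrite addr_gt0// ltr0n.
have w0 : 0 < Num.sqrt n%:R :> R by rewrite sqrtr_gt0 ltr0n.
pose H (z : 'rV[R]_n * 'rV[R]_n) : R :=
  \1_Om z.1 * \1_Om z.2 * (`|f z.1 - f z.2| `^ p * enorm (z.1 - z.2) `^ (- s)).
have H0 z : 0 <= H z by rewrite mulr_ge0 ?mulr_ge0 ?powR_ge0.
have mH : measurable_fun setT H.
  apply: measurable_funM.
    apply: measurable_funM.
      by apply: (measurableT_comp _ measurable_fst); exact: measurable_indic.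
    by apply: (measurableT_comp _ measurable_snd); exact: measurable_indic.
  apply: measurable_funM.
    apply: measurable_fun_powR; apply: measurable_fun_normr.
    by apply: measurable_funB; exact: (measurableT_comp mf).
  apply: measurable_fun_powR; apply: (measurableT_comp measurable_enorm).
  under eq_fun do rewrite -[(- _.2)%R]scaleN1r.
  by apply: measurable_rVD => //; exact: measurable_rVZ.
have mB : measurable_fun setT (EFin \o interior_energy p al Om f).
  by apply/measurable_EFinP; exact: measurable_interior_energy.
rewrite [leRHS](_ : _ = \int[L \x L]_z (H z)%:E)%E; last first.
  rewrite integral_mkcond; apply: eq_integral => -[x y] _; rewrite /patch /H /= !indicE.
  case: ifPn => [/set_mem[/= xO yO]|/negP xy].
    by rewrite !mem_set// !mul1r powRN.
  have [xO|xO] := boolP (x \in Om); last by rewrite !mul0r.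
  have [yO|yO] := boolP (y \in Om); last by rewrite mulr0 !mul0r.
  by exfalso; apply: xy; apply: mem_set; split; exact: set_mem.
rewrite -(ge0_integral_shear2 (EFin \o H))//; last by apply/measurable_EFinP.
rewrite -ge0_integralZl_EFin//; last by move=> z _; rewrite lee_fin interior_energy_ge0.
apply: ge0_le_integral => //.
- by move=> z _; rewrite mule_ge0 ?lee_fin ?powR_ge0 ?interior_energy_ge0.
- exact: measurable_funeM.
- apply/measurable_EFinP; apply: (measurableT_comp mH).
  by apply: measurable_fun_pair => //; exact: measurable_rVD.
move=> [x h] _; rewrite -EFinM lee_fin /H /interior_energy /=.
have -> : x - (x + h) = - h by rewrite opprD addrA subrr sub0r.
rewrite enormN.
set u := \1_Om x * _; set v := `|_| `^ p.
have u0 : 0 <= u by rewrite mulr_ge0.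
have v0 : 0 <= v by rewrite powR_ge0.
rewrite mulrA mulrC -mulrA ler_wpM2l// ler_wpM2l//.
rewrite -powRM ?sqrtr_ge0//.
(* On the diagonal the left side vanishes, a negative power of 0 being 0. *)
have [->|h0] := eqVneq h 0.
  by rewrite normr0 mulr0 powR0 ?powR_ge0// oppr_eq0 gt_eqF.
have hh0 : 0 < `|h| by rewrite normr_gt0.
have eh0 : 0 < enorm h by exact: lt_le_trans (norm_le_enorm h).
rewrite !powRN lef_pV2 ?posrE ?powR_gt0 ?mulr_gt0//.
by apply: powR_le; rewrite ?enorm_le// ltW.
Qed.

End euclidean_norm.

(** * Superlevel sets carrying half of the integral *)

Section level_truncation.
Context {R : realType} {n : nat}.
Local Notation L := (@lebesgue_rV R n).

(** The points with [0 < |f x| < eta] lie in a cube of measure [m] and contribute at most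
    [eta^q * m]. *)
Lemma level_truncation (f : 'rV[R]_n -> R) (q S : R) :
  continuous f -> compact (supp f) -> 0 < q -> 0 < S ->
  (\int[L]_y (`|f y| `^ q)%:E = S%:E)%E ->
  exists2 eta : R, 0 < eta &
   ((S / 2)%:E <= \int[L]_(x in [set x | (eta <= `|f x|)%R]) (`|f x| `^ q)%:E)%E.
Proof.
move=> cf kf q0 S0 fS; have [N N0 HN] := compact_supp_bounded f kf.
have mf : measurable_fun setT f by exact: continuous_measurable_rV.
pose m : R := (2 * N) ^+ n.
have m0 : 0 < m by rewrite exprn_gt0// mulr_gt0.
(* Chosen so that [eta^q * m = S / 2]. *)
pose eta := (S / 2 / m) `^ q^-1.
have eta0 : 0 < eta by rewrite powR_gt0// !divr_gt0.
have etaq : eta `^ q * m = S / 2.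
  by rewrite -powRrM mulVf ?gt_eqF// powRr1 ?divfK ?gt_eqF// !divr_ge0 ?ltW.
exists eta => //; set V := [set x | _].
have mV : measurable V by exact: measurable_superlevel.
pose Q := [set x : 'rV[R]_n | `|x| <= N].
have mQ : measurable Q by exact: measurable_cube.
have mq : measurable_fun setT (fun x => `|f x| `^ q).
  by apply: measurable_fun_powR; exact: measurable_fun_normr.
have mg : measurable_fun setT ((fun x => (`|f x| `^ q)%:E) \_ V).
  by apply/(measurable_restrictT _ mV); apply: measurable_funTS; exact/measurable_EFinP.
have mi : measurable_fun setT (fun x => (\1_Q x : R)%:E).
  by apply/measurable_EFinP; exact: measurable_indic.
have mei : measurable_fun setT (fun x => ((eta `^ q)%:E * (\1_Q x : R)%:E)%E).
  exact: measurable_funeM.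
have g0 x : (0 <= ((fun x => (`|f x| `^ q)%:E) \_ V) x)%E.
  by rewrite /patch; case: ifP => //; rewrite lee_fin powR_ge0.
have ei0 x : (0 <= (eta `^ q)%:E * (\1_Q x : R)%:E)%E by rewrite mule_ge0 ?lee_fin ?powR_ge0.
rewrite integral_mkcond -(@leeD2rE _ (S / 2)%:E)// -EFinD -splitr -fS.
have -> : ((S / 2)%:E = \int[L]_x ((eta `^ q)%:E * (\1_Q x : R)%:E))%E.
  rewrite ge0_integralZl_EFin ?powR_ge0// integral_indic// setIT.
  by rewrite [X in (_ * X)%E](lebesgue_rV_cube N (ltW N0)) -EFinM etaq.
rewrite -ge0_integralD//; apply: ge0_le_integral => //.
- exact/measurable_EFinP.
- exact: emeasurable_funD.
move=> x _; rewrite /patch.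
have [xV|xV] := boolP (x \in V); first by rewrite leeDl.
rewrite add0e -EFinM lee_fin.
have [fx|fx] := eqVneq (f x) 0; first by rewrite fx normr0 powR0 ?gt_eqF// mulr_ge0 ?powR_ge0.
rewrite indicE mem_set ?mulr1; last exact: HN.
apply: powR_le => //; first exact: ltW.
by move: xV; rewrite notin_setE /V /= => /negP; rewrite -ltNge => /ltW.
Qed.

End level_truncation.

(** * Combination of the Hardy and Sobolev estimates *)

Theorem theorem2p1 (R : realType) (n : nat) (p alpha : R)
    (n_gt0 : (0 < n)%N) (p_ge2 : 2 <= p)
    (alpha_gt1 : 1 < alpha) (alpha_lt : alpha < Num.min n%:R p) :
  let pstar := n%:R * p / (n%:R - alpha) in
  exists2 c : R, 0 < c &
    forall Omega : set 'rV[R]_n,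
      domain Omega -> convex_set Omega -> boundary Omega !=set0 ->
    forall f : 'rV[R]_n -> R, test_function Omega f ->
      (\int[lebesgue_rV n \x lebesgue_rV n]_(z in Omega `*` Omega)
          (`|f z.1 - f z.2| `^ p / enorm (z.1 - z.2) `^ (n%:R + alpha))%:E
        >= c%:E * poweR (\int[lebesgue_rV n]_(x in Omega)
                          (`|f x| `^ pstar)%:E) (p / pstar))%E.
Proof.
move=> q; have p0 : 0 < p by exact: lt_le_trans p_ge2.
have al0 : 0 < alpha by exact: lt_trans alpha_gt1.
have aln : alpha < n%:R by move: alpha_lt; rewrite lt_min => /andP[].
have nR0 : 0 < n%:R :> R by rewrite ltr0n.
have q0 : 0 < q by rewrite divr_gt0 ?mulr_gt0 ?subr_gt0.
have qE : p / q = 1 - alpha / n%:R.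
  by rewrite /q; field; rewrite ?gt_eqF ?subr_gt0.
have [K K0 HK] := fractional_hardy p alpha p0 alpha_gt1.
pose k : R := Num.sqrt n%:R `^ (- (n%:R + alpha)).
have k0 : 0 < k by rewrite powR_gt0// sqrtr_gt0.
pose C := @sobolev_cst R n p alpha.
have C0 : 0 < C by exact: powR_gt0.
have K1 : 0 < K + 1 by rewrite addr_gt0.
(* [k] comes from the change of norm, [C / 2] from the Sobolev bound on a set carrying half of [S],
   and [K + 1] from the Hardy bound on the sum of the two energies. *)
exists (k * (C / 2) / (K + 1)); first by rewrite divr_gt0// mulr_gt0// divr_gt0.
move=> Om [oOm _] _ _ f [sf kf fOm].
have cf : continuous f by have [] := sf [::].
have f0 x : ~ Om x -> f x = 0.
  by move=> xO; apply: contrapT => /eqP /supp_neq0 /fOm.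
have mOm : measurable Om by exact: open_measurable_rV.
have mf : measurable_fun setT f by exact: continuous_measurable_rV.
have -> : (\int[lebesgue_rV n]_(x in Om) (`|f x| `^ q)%:E =
           \int[lebesgue_rV n]_x (`|f x| `^ q)%:E)%E.
  rewrite integral_mkcond; apply: eq_integral => x _; rewrite /patch.
  case: ifPn => //; rewrite notin_setE => /f0 ->.
  by rewrite normr0 powR0// gt_eqF.
have := integral_powR_lty f cf kf q q0.
have : (0 <= \int[lebesgue_rV n]_x (`|f x| `^ q)%:E)%E by exact: integral_ge0.
case E : (\int[lebesgue_rV n]_x (`|f x| `^ q)%:E)%E => [S| |]//; rewrite lee_fin => S_ge0 _.
apply: le_trans (interior_energy_le_gagliardo p alpha Om f n_gt0 al0 mOm mf).
rewrite -/k poweR_EFin qE.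
set J := (\int[_]_z _)%E.
have J0 : (0 <= J)%E by apply: integral_ge0 => z _; rewrite lee_fin interior_energy_ge0.
(* The exponent [1 - alpha / n] is positive, so for [S = 0] the left side is 0. *)
have [S0|S0] := eqVneq S 0.
  rewrite S0 powR0 ?mule0 ?mule_ge0// ?lee_fin ?ltW//.
  by rewrite gt_eqF// subr_gt0 ltr_pdivrMr// mul1r.
have {S_ge0}S0 : 0 < S by rewrite lt_def S0.
have [eta eta0 Heta] := level_truncation f q S cf kf q0 S0 E.
have r0 := @level_radius_gt0 R n p alpha S S0 eta eta0.
set M := level_radius p alpha S eta in r0.
have HI := HK n Om f M mOm mf f0
  (integral_exterior_energy_lty p alpha Om f oOm cf kf fOm M p0 al0 r0).
have HS := sobolev_truncated p alpha Om f n_gt0 p0 al0 aln mOm mf f0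
  S eta M S0 eta0 E (lexx M).
(* The exterior energy is at most [K * J], so the Sobolev bound involves [J] alone; [M] has
   disappeared. *)
have HJ : ((C * S `^ (- (alpha / n%:R)) * (S / 2))%:E <= (K + 1)%:E * J)%E.
  rewrite EFinM; apply: (@le_trans _ _ (_ * _)%E).
    by apply: lee_wpmul2l Heta; rewrite lee_fin mulr_ge0 ?powR_ge0.
  apply: le_trans HS _; rewrite EFinD ge0_muleDl ?lee_fin ?(ltW K0)// mul1e; exact: leeD2r.
rewrite -EFinM.
have -> : k * (C / 2) / (K + 1) * S `^ (1 - alpha / n%:R) =
    k * ((K + 1)^-1 * (C * S `^ (- (alpha / n%:R)) * (S / 2))).
  have -> : S `^ (1 - alpha / n%:R) = S * S `^ (- (alpha / n%:R)).
    by rewrite powRD ?(gt_eqF S0) ?implybT// powRr1// ltW.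
  ring.
rewrite EFinM lee_wpmul2l ?lee_fin ?(ltW k0)//.
by rewrite EFinM lee_pdivrMl.
Qed.
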